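(* For $n\ge5$, the number $M(f_n)$ of maximal closed substrings (counted as occurrences, i.e., by position pairs $(i,j)$) in the Fibonacci word $f_n$ is $$M(f_n)=\begin{cases}F_n+F_{n-2}-1, & \text{if } n \text{ is odd},\\ F_n+F_{n-2}-2, & \text{if } n \text{ is even}.\end{cases}$$ Furthermore, $M(f_n)\approx\left(1+\frac{1}{\phi^2}\right)F_n\approx 1.382\,F_n$, in the sense that $M(f_n)<F_n+F_{n-2}$ and $M(f_n)/F_n\to 1+1/\phi^2$ as $n\to\infty$, where $\phi=\frac{1+\sqrt5}{2}$.
   Context: Fibonacci words are defined by $f_0=0$, $f_1=1$, $f_n=f_{n-1}f_{n-2}$ for $n\ge2$, and $F_n=|f_n|$ (so $F_0=F_1=1$, $F_n=F_{n-1}+F_{n-2}$). Strings are indexed from 1; $w[i..j]$ denotes an occurrence. A border of a string $x$ is a nonempty string that is both a proper prefix and a proper suffix of $x$. A string $x$ is closed if $|x|=1$, or $|x|\ge2$ and $x$ has a border occurring in $x$ only as a prefix and as a suffix and nowhere else. In a string $w[1..N]$, an occurrence $w[i..j]$ is maximal right-closed if it is closed and either $j=N$ or $w[i..j+1]$ is not closed; maximal left-closed if it is closed and either $i=1$ or $w[i-1..j]$ is not closed; and a maximal closed substring (MCS) if it is both maximal left-closed and maximal right-closed. *)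

(* Defs.v *)
From mathcomp Require Import all_boot all_order all_algebra.
From mathcomp Require Import all_classical all_reals all_analysis.

Set Implicit Arguments.
Unset Strict Implicit.
Unset Printing Implicit Defensive.

Import Num.Theory.
Import numFieldNormedType.Exports.

Section ClosedWords.
Variable T : eqType.
Implicit Types (w x b s t : seq T) (i j : nat).

Definition border b x : bool :=
  [&& b != [::], b != x, prefix b x & suffix b x].

(* Each factorization x = s ++ b ++ t is one occurrence of b in x. *)
Definition closed_word x : Prop :=
  size x = 1 \/
  (2 <= size x /\
   exists2 b, border b x &
     forall s t, x = s ++ b ++ t -> s = [::] \/ t = [::]).

(* w[i..j], with positions counted from 1 and both ends included. *)
Definition factor w i j : seq T := drop i.-1 (take j w).

Definition position_pair w i j : bool := [&& 1 <= i, i <= j & j <= size w].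

Definition max_right_closed w i j : Prop :=
  closed_word (factor w i j) /\
  (j = size w \/ ~ closed_word (factor w i j.+1)).

Definition max_left_closed w i j : Prop :=
  closed_word (factor w i j) /\
  (i = 1 \/ ~ closed_word (factor w i.-1 j)).

Definition mcs w i j : Prop :=
  [/\ position_pair w i j, max_left_closed w i j & max_right_closed w i j].

(* Positions lie in {1, ..., size w}; index 0 of the ordinal type never
   contributes, by position_pair. *)
Definition num_mcs w : nat :=
  #|[pred p : 'I_(size w).+1 * 'I_(size w).+1 | `[< mcs w p.1 p.2 >]]|.

End ClosedWords.

Fixpoint fib_word (n : nat) : seq nat :=
  match n with
  | 0 => [:: 0]
  | n1.+1 => match n1 with
             | 0 => [:: 1]
             | n2.+1 => fib_word n1 ++ fib_word n2
             end
  end.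

Definition fib_len (n : nat) : nat := size (fib_word n).

Definition golden (R : realType) : R := ((1 + Num.sqrt 5) / 2)%R.

(* Main.v *)
(* A closed substring of [w] is a pair of consecutive occurrences, at positions
   [p < q], of a word [b] (empty when the substring is a letter), and it is
   maximal exactly when [b] cannot be extended on either side.  So the maximal
   closed substrings are the pairs [(p, q)] that are preceded by different
   letters and for which the longest common extension [lce w p q] exceeds all
   [lce w p r], [p < r < q].

   The morphism 1 -> 10, 0 -> 1 sends [f_n] to [f_(n+1)], and carries these pairs
   of [f_n], except the one given by the last letter, bijectively onto the pairs
   of [f_(n+1)] with nonempty [b].  The pairs of [f_(n+1)] with empty [b] are its
   letters that differ from both neighbours, and there are
   [F_(n-1) + F_(n-3) + 2 [n+1 odd]] of these.  Summing the resulting recurrence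
   from [n = 5] gives the count. *)

Require Import Defs.
From mathcomp Require Import all_boot all_order all_algebra.
From mathcomp Require Import all_classical all_reals all_analysis.
From mathcomp Require Import zify ring lra.

Import Order.TTheory GRing.Theory Num.Theory.
Import numFieldNormedType.Exports.

(** * Maximal closed substrings as pairs of positions *)

Fixpoint lcp (T : eqType) (s t : seq T) : nat :=
  match s, t with
  | x :: s', y :: t' => if x == y then (lcp T s' t').+1 else 0
  | _, _ => 0
  end.
Arguments lcp {T} s t.

Definition lce (T : eqType) (w : seq T) (p q : nat) : nat :=
  lcp (drop p w) (drop q w).
Arguments lce {T} w p q.

Lemma leq_lcp (T : eqType) (x0 : T) (s t : seq T) (k : nat) :
  k <= lcp s t <->
  [/\ k <= size s, k <= size t & forall i, i < k -> nth x0 s i = nth x0 t i].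
Proof.
elim: s t k => [|x s IH] [|y t] [|k] /=; try by split=> //; case.
case: eqP => [<-|xy].
  rewrite ltnS IH; split=> -[ks kt h]; split=> //.
    by case=> [|i] //=; apply: h.
  by move=> i ik; apply: (h i.+1).
by split=> // -[_ _ /(_ 0 isT)].
Qed.

Lemma leq_lce (T : eqType) (x0 : T) (w : seq T) (p q k : nat) :
  p < q -> q <= size w ->
  k <= lce w p q <->
  q + k <= size w /\ forall i, i < k -> nth x0 w (p + i) = nth x0 w (q + i).
Proof.
move=> pq qN; rewrite /lce (leq_lcp T x0) !size_drop; split.
  move=> [_ k2 h]; split; first by lia.
  by move=> i /h; rewrite !nth_drop.
move=> [k1 h]; split; [lia|lia|].
by move=> i /h; rewrite !nth_drop.
Qed.

(* [w[p..j)] is closed with border [w[q..j)]; the empty border accounts for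
   words of length 1. *)
Definition closed_at (T : eqType) (w : seq T) (p q j : nat) : Prop :=
  [/\ p < q, q <= j, j <= q + lce w p q
    & forall r, p < r -> r < q -> lce w p r < j - q].
Arguments closed_at {T} w p q j.

Lemma factorE (T : eqType) (x0 : T) (w : seq T) (p j i : nat) :
  p <= j -> j <= size w -> i < j - p ->
  nth x0 (Defs.factor w p.+1 j) i = nth x0 w (p + i).
Proof. by move=> pj jN ij; rewrite /Defs.factor /= nth_drop nth_take //; lia. Qed.

Lemma size_factor (T : eqType) (w : seq T) (p j : nat) :
  j <= size w -> size (Defs.factor w p.+1 j) = j - p.
Proof. by move=> jN; rewrite /Defs.factor /= size_drop size_takel. Qed.

(** The witness [q] is where the last occurrence of the border starts. A single letter takes
    [q = j], and the last clause of [closed_at] then leaves no position strictly between [p] and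
    [j]. *)
Lemma closed_wordP (T : eqType) (w : seq T) (p j : nat) :
  p < j -> j <= size w ->
  closed_word (Defs.factor w p.+1 j) <-> exists q, closed_at w p q j.
Proof.
move=> pj jN.
have [x0 _] : exists x0 : T, True by case: (w) jN => [|x ?] /= ?; [lia|exists x].
set x := Defs.factor _ _ _.
have sx : size x = j - p by rewrite /x size_factor.
have nx i : i < j - p -> nth x0 x i = nth x0 w (p + i).
  by move=> ij; rewrite /x factorE //; lia.
clearbody x.
split.
  case=> [s1|[s2 [b /and4P[bn bx /prefixP[u xu] /suffixP[v xv]] occ]]].
    by exists j; split=> //; move: s1; rewrite sx => s1; lia.
  have sb : size b < size x.
    rewrite ltn_neqAle {2}xu size_cat leq_addr andbT.
    apply: contraNneq bx => sbx; rewrite xu; move: sbx; rewrite xu size_cat.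
    by case: (u) => [|? ?] /=; [rewrite cats0|lia].
  have b0 : 0 < size b by case: (b) bn.
  have nb i : i < size b -> nth x0 b i = nth x0 w (p + i).
    by move=> ib; rewrite -nx ?xu ?nth_cat ?ib //; lia.
  have sv : size v = size x - size b by rewrite xv size_cat addnK.
  have nbv i : i < size b -> nth x0 b i = nth x0 w (j - size b + i).
    move=> ib; have -> : j - size b + i = p + (size v + i) by lia.
    rewrite -nx; last by lia.
    by rewrite xv nth_cat ltnNge leq_addr addKn.
  exists (j - size b); split; [lia|lia| |].
    have : size b <= lce w p (j - size b); last by lia.
    apply/(leq_lce T x0); [lia|lia|split=> [|i ib]; first by lia].
    by rewrite -nb // -nbv.
  move=> r pr rq; rewrite ltnNge; apply/negP.
  move/(leq_lce T x0); case; [lia|lia|move=> h1 h2].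
  pose s := take (r - p) x; pose t := drop (r - p + size b) x.
  have ss : size s = r - p by rewrite size_takel //; lia.
  have st : size t = size x - (r - p + size b) by rewrite size_drop.
  case: (occ s t).
  - apply: (@eq_from_nth _ x0); first by rewrite !size_cat ss st; lia.
    move=> i ix; rewrite !nth_cat ss; case: ltnP => [ir|ri].
      by rewrite nth_take.
    case: ltnP => ib; last by rewrite nth_drop; congr nth; lia.
    rewrite nb // nx; last by lia.
    by rewrite [RHS]h2; [congr nth; lia|lia].
  - by move=> s0; move: ss; rewrite s0 /=; lia.
  - by move=> t0; move: st; rewrite t0 /=; lia.
move=> [q [pq qj jq hr]].
have [qE|qlt] : q = j \/ q < j by lia.
  left; rewrite sx; have [->|?] : j = p.+1 \/ p.+1 < q by lia.
    by rewrite subSnn.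
  by have := hr p.+1; lia.
right; split; first by rewrite sx; lia.
have : j - q <= lce w p q by lia.
move/(leq_lce T x0); case; [lia|lia|move=> _ hm].
have sb : size (take (j - q) x) = j - q by rewrite size_takel; lia.
exists (take (j - q) x); first (apply/and4P; split).
- by rewrite -size_eq0 sb; lia.
- by apply/eqP=> /(congr1 size); rewrite sb; lia.
- exact: prefix_take.
- apply/suffixP; exists (take (q - p) x).
  apply: (@eq_from_nth _ x0); rewrite ?size_cat ?sb ?size_takel; [lia|lia|].
  move=> i ix; rewrite nth_cat size_takel; last by lia.
  case: ltnP => iq; first by rewrite nth_take.
  rewrite nth_take; last by lia.
  rewrite !nx; [|lia|lia].
  by rewrite [RHS]hm; [congr nth; lia|lia].
move=> s t xE.
have sE : size s + (j - q) + size t = j - p.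
  by rewrite -sx [in RHS]xE !size_cat sb; lia.
case: s xE sE => [|c s] xE; first by left.
case: t xE => [|d t] xE; first by right.
move=> /= sE; set m := (size s).+1 in sE.
have := hr (p + m).
have : j - q <= lce w p (p + m).
  apply/(leq_lce T x0); [lia|lia|split; first by lia].
  move=> i ij; rewrite -addnA -!nx; [|lia|lia].
  rewrite [in RHS]xE nth_cat /= -/m ltnNge leq_addr /= addKn nth_cat sb ij.
  by rewrite nth_take.
by lia.
Qed.

(** If the agreement runs past [j], the same [q] closes the longer word. Otherwise, a new [q' < q]
    would be a forbidden occurrence of the old border, and for [q' > q] the new border would already
    occur at [q]. *)
Lemma right_maximalP (T : eqType) (w : seq T) (p q j : nat) :
  j <= size w -> closed_at w p q j ->
  (j = size w \/ ~ exists q', closed_at w p q' j.+1) <-> j = q + lce w p q.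
Proof.
move=> jN [pq qj jq hr]; split.
  case=> [jE|h].
    have [x0 _] : exists x0 : T, True by case: (w) jN => [|x ?] /= ?; [lia|exists x].
    have := (leq_lce T x0 w p q (lce w p q) pq (leq_trans qj jN)).1 (leqnn _).
    by case; lia.
  have [//|lt] : j = q + lce w p q \/ j < q + lce w p q by lia.
  case: h; exists q; split=> //; first by lia.
  by move=> r pr rq; have := hr r pr rq; lia.
move=> jE; right=> -[q' [pq' qj' jq' hr']].
have [e|[lt|lt]] : q' = q \/ (q' < q \/ q < q') by lia.
- by subst q'; lia.
- by have := hr q' pq' lt; lia.
- by have := hr' q pq lt; lia.
Qed.

(** Equal letters before [p] and [q] extend the border to the left. Conversely, let [q'] close the
    word starting at [p.-1]: [q' = q.-1] forces equal letters, and [q' < q.-1] puts the old border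
    at [q'.+1], before [q]. *)
Lemma left_maximalP (T : eqType) (x0 : T) (w : seq T) (p q j : nat) :
  0 < p -> j <= size w -> closed_at w p q j ->
  (~ exists q', closed_at w p.-1 q' j) <-> nth x0 w p.-1 <> nth x0 w q.-1.
Proof.
move=> p0 jN [pq qj jq hr].
have jq' : j - q <= lce w p q by lia.
move/(leq_lce T x0): jq'; case; [lia|lia|move=> _ hm].
split=> h e; apply: h.
  exists q.-1; split; [lia|lia| |].
    have : (j - q).+1 <= lce w p.-1 q.-1; last by lia.
    apply/(leq_lce T x0); [lia|lia|split; first by lia].
    case=> [|i] ij; first by rewrite !addn0.
    have -> : p.-1 + i.+1 = p + i by lia.
    by rewrite hm //; congr nth; lia.
  move=> r pr rq; rewrite ltnNge; apply/negP.
  move/(leq_lce T x0); case; [lia|lia|move=> h1 h2].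
  have := hr r.+1.
  have : j - q <= lce w p r.+1; last by lia.
  apply/(leq_lce T x0); [lia|lia|split; first by lia].
  move=> i ij; have := h2 i.+1.
  have -> : p.-1 + i.+1 = p + i by lia.
  by rewrite addnS; apply; lia.
case: e => q' [pq' qj' jq'' hr'].
have : j - q' <= lce w p.-1 q' by lia.
move/(leq_lce T x0); case; [lia|lia|move=> _ hm'].
have [e|[lt|lt]] : q' = q.-1 \/ (q' < q.-1 \/ q <= q') by lia.
- by have := hm' 0; rewrite !addn0 -e; apply; lia.
- have := hr q'.+1.
  have : j - q <= lce w p q'.+1; last by lia.
  apply/(leq_lce T x0); [lia|lia|split; first by lia].
  move=> i ij; have := hm' i.+1.
  have -> : p.-1 + i.+1 = p + i by lia.
  by rewrite addnS; apply; lia.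
(* the shorter border of [w[p-1..j)] reappears inside the border of [w[p..j)] *)
have := hr' (p + q' - q).
have : j - q' <= lce w p.-1 (p + q' - q); last by lia.
apply/(leq_lce T x0); [lia|lia|split; first by lia].
move=> i ij; rewrite hm' //.
have -> : q' + i = q + (q' - q + i) by lia.
by rewrite -hm; [congr nth; lia|lia].
Qed.

(** The border stays implicit: right maximality fixes its length as [lce w p q]. Allowing
    [q = size w] admits the last letter of [w], with its empty border. *)
Definition mcs_pair (T : eqType) (x0 : T) (w : seq T) (p q : nat) : bool :=
  [&& p < q, q <= size w, (p == 0) || (nth x0 w p.-1 != nth x0 w q.-1)
    & all (fun r => lce w p r < lce w p q) (iota p.+1 (q - p.+1))].
Arguments mcs_pair {T} x0 w p q.

Lemma mcs_pairP (T : eqType) (x0 : T) (w : seq T) (p q : nat) :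
  reflect [/\ p < q, q <= size w, p = 0 \/ nth x0 w p.-1 <> nth x0 w q.-1
            & forall r, p < r -> r < q -> lce w p r < lce w p q]
          (mcs_pair x0 w p q).
Proof.
apply: (iffP and4P) => -[pq qN h /= hr]; split=> //.
- by case/orP: h => /eqP; [left|right].
- by move=> r pr rq; apply: (allP hr); rewrite mem_iota; lia.
- by apply/orP; case: h => /eqP; [left|right].
- by apply/allP=> r; rewrite mem_iota => hr'; apply: hr; lia.
Qed.

Definition mcs_pairs (T : eqType) (x0 : T) (w : seq T) : seq (nat * nat) :=
  [seq pq <- [seq (p, q) | p <- iota 0 (size w).+1, q <- iota 0 (size w).+1]
     | mcs_pair x0 w pq.1 pq.2].
Arguments mcs_pairs {T} x0 w.

Lemma mem_mcs_pairs (T : eqType) (x0 : T) (w : seq T) (p q : nat) :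
  ((p, q) \in mcs_pairs x0 w) = mcs_pair x0 w p q.
Proof.
rewrite mem_filter andb_idr // => /(mcs_pairP T x0 w p q) [pq qN _ _].
by apply/allpairsP; exists (p, q); split; rewrite ?mem_iota //=; lia.
Qed.

Lemma uniq_mcs_pairs (T : eqType) (x0 : T) (w : seq T) : uniq (mcs_pairs x0 w).
Proof.
by apply: filter_uniq; apply: allpairs_uniq; rewrite ?iota_uniq // => -[? ?] [? ?].
Qed.

Lemma mcsP (T : eqType) (x0 : T) (w : seq T) (i j : nat) :
  mcs w i j <->
  exists p q, [/\ mcs_pair x0 w p q, i = p.+1 & j = q + lce w p q].
Proof.
split.
  case=> /and3P[]; case: i => [//|p] _ pj jN [cl hl] [_ hr].
  have [q hq] := (closed_wordP T w p j pj jN).1 cl.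
  exists p, q; have jE : j = q + lce w p q.
    apply/(right_maximalP T w p q j jN hq); case: hr => [|hr]; first by left.
    have [?|jN'] : j = size w \/ j < size w by lia.
      by left.
    by right=> hc; apply: hr; apply/closed_wordP => //; lia.
  split=> //; case: (hq) => pq qj jq hrr; apply/mcs_pairP; split; [lia|lia| |].
    case: (posnP p) => p0; first by left.
    right; apply/(left_maximalP T x0 w p q j p0 jN hq) => hc.
    case: hl => [|hl]; first by lia.
    apply: hl => /=; rewrite -(prednK p0).
    by apply/closed_wordP => //; lia.
  by move=> r pr rq; have := hrr r pr rq; lia.
move=> [p [q [h -> ->]]] {i j}; case/mcs_pairP: h => pq qN hl hr.
set j := q + lce w p q.
have jN : j <= size w by case: ((leq_lce T x0 w p q (lce w p q) pq qN).1 (leqnn _)).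
have pj : p < j by lia.
have hq : closed_at w p q j.
  split=> //; first by lia.
  by move=> r pr rq; have := hr r pr rq; lia.
have cl : closed_word (Defs.factor w p.+1 j) by apply/closed_wordP => //; exists q.
split.
- by rewrite /position_pair /=; lia.
- split=> //; case: (posnP p) => p0; first by left; rewrite p0.
  right=> /=; rewrite -{1}(prednK p0).
  case: hl => [|hl]; first by lia.
  move/(left_maximalP T x0 w p q j p0 jN hq): hl => hl hc.
  by apply: hl; apply/closed_wordP => //; lia.
- split=> //; have [|h] := (right_maximalP T w p q j jN hq).2 erefl; first by left.
  have [?|jN'] : j = size w \/ j < size w by lia.
    by left.
  by right=> hc; apply: h; apply/closed_wordP => //; lia.
Qed.

Lemma num_mcsE (T : eqType) (x0 : T) (w : seq T) :
  num_mcs w = size (mcs_pairs x0 w).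
Proof.
rewrite /num_mcs cardE.
set A := enum _; pose g (ij : 'I_(size w).+1 * 'I_(size w).+1) := (val ij.1, val ij.2).
pose h (pq : nat * nat) := (pq.1.+1, pq.2 + lce w pq.1 pq.2).
rewrite -(size_map g) -(size_map h (mcs_pairs x0 w)); apply: perm_size; apply: uniq_perm.
- rewrite map_inj_uniq; first exact: enum_uniq.
  by move=> [i j] [i' j'] [/val_inj -> /val_inj ->].
- rewrite map_inj_in_uniq; first exact: uniq_mcs_pairs.
  move=> [p q] [p' q']; rewrite !mem_mcs_pairs.
  move=> /mcs_pairP[pq _ _ hr] /mcs_pairP[pq' _ _ hr'] [pp qq].
  rewrite -pp in pq' hr' qq *; congr pair.
  (* With a common start and a common end, the smaller second position has the longer extension,
     against the maximality required by the other pair. *)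
  have [//|[lt|lt]] : q = q' \/ (q < q' \/ q' < q) by lia.
  + by have := hr' q pq lt; lia.
  + by have := hr q' pq' lt; lia.
move=> [i j]; apply/mapP/mapP.
  move=> [[i1 j1]]; rewrite mem_enum inE /= => hm [-> ->].
  have [p [q [hpq ii jj]]] := (mcsP T x0 w _ _).1 hm.
  by exists (p, q); rewrite ?mem_mcs_pairs // /h /= -ii -jj.
move=> [[p q]]; rewrite mem_mcs_pairs => hpq [-> ->].
have hm : mcs w p.+1 (q + lce w p q) by apply: (mcsP T x0 w _ _).2; exists p, q.
case: (hm) => /and3P[_ h1 h2] _ _.
exists (inord p.+1, inord (q + lce w p q)); last first.
  by rewrite /g /= !inordK //; lia.
by rewrite mem_enum inE /= !inordK; [exact: hm|lia|lia].
Qed.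

(** * The Fibonacci morphism *)

Definition binary (w : seq nat) : bool := all (fun x => x < 2) w.

Fixpoint fib_morph (w : seq nat) : seq nat :=
  if w is x :: w' then
    1 :: (if x == 0 then fib_morph w' else 0 :: fib_morph w')
  else [::].

Lemma fib_morph_cat (u v : seq nat) :
  fib_morph (u ++ v) = fib_morph u ++ fib_morph v.
Proof. by elim: u => //= x u ->; case: eqP. Qed.

Lemma fib_word_morph (n : nat) : fib_word n.+1 = fib_morph (fib_word n).
Proof.
suff: fib_word n.+1 = fib_morph (fib_word n) /\
      fib_word n.+2 = fib_morph (fib_word n.+1) by case.
elim: n => [//|n [IH1 IH2]]; split=> //.
have := fib_morph_cat (fib_word n.+1) (fib_word n).
by rewrite -IH1 -IH2 => /esym.
Qed.

Lemma binary_fib_morph (w : seq nat) : binary (fib_morph w).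
Proof. by elim: w => //= x w IH; case: eqP. Qed.

(** At a mismatch the images 1 and 10 still share their first letter. They part right after it,
    because whatever follows the image of 0 starts with 1. Hence one extra letter, provided neither
    word is exhausted. *)
Lemma lcp_fib_morph (s t : seq nat) : binary s -> binary t ->
  lcp (fib_morph s) (fib_morph t) =
  size (fib_morph (take (lcp s t) s)) + (lcp s t < minn (size s) (size t)).
Proof.
elim: s t => [|x s IH] [|y t]; rewrite ?min0n ?minn0 //=.
move=> /andP[x2 bs] /andP[y2 bt]; rewrite minnSS ltnS.
have [<-|xy] := eqVneq x y.
  by case: x x2 => [|x] _ /=; rewrite IH.
case: x x2 xy => [|[|//]] _; case: y y2 => [|[|//]] _ //= _.
  by case: s {IH bs}.
by case: t {bt}.
Qed.

Definition image_pos (w : seq nat) (p : nat) : nat := size (fib_morph (take p w)).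

Lemma image_posD (w : seq nat) (p k : nat) :
  image_pos w (p + k) = image_pos w p + size (fib_morph (take k (drop p w))).
Proof. by rewrite /image_pos takeD fib_morph_cat size_cat. Qed.

Lemma image_posS (w : seq nat) (p : nat) : p < size w ->
  image_pos w p.+1 = image_pos w p + (nth 2 w p != 0).+1.
Proof.
move=> pN; rewrite -addn1 image_posD (drop_nth 2 pN) /= take0.
by case: (nth _ _ _).
Qed.

Lemma image_pos_mono (w : seq nat) (p q : nat) : p <= q -> q <= size w ->
  image_pos w p + (q - p) <= image_pos w q.
Proof.
elim: q => [|q IH] pq qN; first by case: p pq => // _; rewrite addn0.
have [->|lt] : p = q.+1 \/ p <= q by lia.
  by rewrite subnn addn0.
by rewrite image_posS //; have := IH lt; lia.
Qed.

Lemma image_pos_size (w : seq nat) : image_pos w (size w) = size (fib_morph w).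
Proof. by rewrite /image_pos take_size. Qed.

Lemma drop_image_pos (w : seq nat) (p : nat) :
  drop (image_pos w p) (fib_morph w) = fib_morph (drop p w).
Proof.
by rewrite -{2}(cat_take_drop p w) fib_morph_cat drop_size_cat.
Qed.

Lemma nth_image_pos (w : seq nat) (p : nat) : p < size w ->
  nth 2 (fib_morph w) (image_pos w p) = 1.
Proof.
move=> pN; rewrite -[image_pos w p]addn0 -nth_drop drop_image_pos.
by rewrite (drop_nth 2 pN).
Qed.

Lemma nth_image_pos_succ (w : seq nat) (p : nat) : p < size w ->
  nth 2 w p <> 0 -> nth 2 (fib_morph w) (image_pos w p).+1 = 0.
Proof.
move=> pN; rewrite -[(image_pos w p).+1]addn1 -nth_drop drop_image_pos.
by rewrite (drop_nth 2 pN) /=; case: eqP.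
Qed.

Lemma binary_nth (w : seq nat) (i : nat) : binary w -> i < size w -> nth 2 w i < 2.
Proof. by move=> /(all_nthP 2) h /h. Qed.

(** The image of 0 ends in 1 and that of 1 ends in 0, so preceding letters are swapped and left
    maximality is preserved. *)
Lemma nth_image_pos_pred (w : seq nat) (p : nat) :
  binary w -> 0 < p -> p <= size w ->
  nth 2 (fib_morph w) (image_pos w p).-1 = 1 - nth 2 w p.-1.
Proof.
case: p => [//|p] bw _ pN /=; rewrite image_posS //.
have := binary_nth w p bw pN; have := nth_image_pos_succ w p pN.
have := nth_image_pos w p pN.
case: (nth 2 w p) => [|[|//]] h1 h2 _ /=; first by rewrite addn1.
by rewrite addn2 h2.
Qed.

(** Each letter image contains a single 1, in front, so the 1s mark where the images start. *)
Lemma image_pos_onto (w : seq nat) (i : nat) :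
  nth 2 (fib_morph w) i = 1 -> exists2 r, r < size w & i = image_pos w r.
Proof.
elim: w i => [|x w IH] i; first by rewrite nth_nil.
case: i => [|i] /=; first by exists 0.
case: eqP => x0.
  by move=> /IH[r rN ->]; exists r.+1; rewrite // /image_pos /= x0 eqxx.
case: i => [//|i] /= /IH[r rN ->].
by exists r.+1; rewrite // /image_pos /=; move/eqP/negbTE: x0 => ->.
Qed.

Lemma zero_after_one (w : seq nat) (i : nat) :
  nth 2 (fib_morph w) i = 0 -> 0 < i /\ nth 2 (fib_morph w) i.-1 = 1.
Proof.
elim: w i => [|x w IH] i; first by rewrite nth_nil.
case: i => [//|i] /=; case: eqP => x0.
  by move=> /IH[]; case: i.
by case: i => [|i] //= /IH[]; case: i.
Qed.

(** Adding the common start [image_pos w p] turns the extensions for different [q] into values of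
    [image_pos], comparable by monotonicity. The extra letter is lost exactly when the border is a
    suffix of [w]. *)
Lemma lce_image_pos (w : seq nat) (p q : nat) :
  binary w -> p < q -> q <= size w ->
  image_pos w p + lce (fib_morph w) (image_pos w p) (image_pos w q) =
  image_pos w (p + lce w p q) + (q + lce w p q < size w).
Proof.
move=> bw pq qN; rewrite /lce !drop_image_pos lcp_fib_morph; last 2 first.
- by move: bw; rewrite -{1}(cat_take_drop p w) /binary all_cat => /andP[].
- by move: bw; rewrite -{1}(cat_take_drop q w) /binary all_cat => /andP[].
rewrite image_posD addnA !size_drop; congr (_ + nat_of_bool _).
by rewrite (minn_idPr _) ?ltn_subRL; [|lia].
Qed.

(* Applying [fib_morph] destroys a pair whose border [b0] is a suffix of [w]
   when [b1] occurs between the two occurrences of [b0]: both [b0] and [b1] then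
   give occurrences of the same word in the image. *)
Definition tail_ok (w : seq nat) : Prop :=
  forall p q r, mcs_pair 2 w p q -> p < r -> r < q ->
    q + lce w p q = size w -> last 2 w = 0 -> (lce w p r).+1 = lce w p q -> False.

(* [lia] only identifies [size w] at [Equality.sort nat] with [size w] at [nat]
   after simplification. *)
Ltac nlia := simpl in *; lia.

(** Monotonicity of [image_pos] transfers the comparison of extensions, except when the border at
    [q] is a suffix and so gets no extra letter while [r] gets one. A lead of two letters absorbs
    this, and so does a lead of one if the last letter is 1, whose image has length 2; [tail_ok]
    excludes the rest. *)
Lemma mcs_pair_image_pos (w : seq nat) (p q : nat) :
  binary w -> tail_ok w -> p < q -> q < size w ->
  mcs_pair 2 (fib_morph w) (image_pos w p) (image_pos w q) = mcs_pair 2 w p q.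
Proof.
move=> bw tw pq qN.
have iq : image_pos w q < size (fib_morph w).
  by rewrite -image_pos_size; have := image_pos_mono w q (size w); nlia.
have ipq : image_pos w p < image_pos w q by have := image_pos_mono w p q; nlia.
have lq := lce_image_pos w p q bw pq (ltnW qN).
have [lN lm] := (leq_lce nat 2 w p q (lce w p q) pq (ltnW qN)).1 (leqnn _).
have left_eq : 0 < p -> nth 2 (fib_morph w) (image_pos w p).-1 <>
                   nth 2 (fib_morph w) (image_pos w q).-1 <->
                   nth 2 w p.-1 <> nth 2 w q.-1.
  move=> p0; rewrite !nth_image_pos_pred //; [|nlia|nlia|nlia].
  have : nth 2 w p.-1 < 2 by apply: binary_nth => //; nlia.
  have : nth 2 w q.-1 < 2 by apply: binary_nth => //; nlia.
  by case: (nth _ _ p.-1) => [|[]]; case: (nth _ _ q.-1) => [|[]].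
apply/mcs_pairP/mcs_pairP=> -[_ _ hl hr]; split=> //; [nlia| | |nlia| |].
- case: (posnP p) => p0; first by left.
  right; apply/left_eq => //; case: hl => // hp.
  by have := image_pos_mono w 0 p; nlia.
- move=> r pr rq; rewrite ltnNge; apply/negP => Lr.
  have lr := lce_image_pos w p r bw pr (ltnW (ltn_trans rq qN)).
  have [rN _] := (leq_lce nat 2 w p r (lce w p r) pr (ltnW (ltn_trans rq qN))).1 (leqnn _).
  have := hr (image_pos w r).
  have := image_pos_mono w p r; have := image_pos_mono w r q.
  have := image_pos_mono w (p + lce w p q) (p + lce w p r).
  by nlia.
- case: (posnP p) => p0; first by left; rewrite p0 /image_pos take0.
  by right; apply/left_eq => //; case: hl => //; nlia.
move=> r' pr' rq'.
(* A competitor [r'] must agree with [image_pos w p] on at least one letter, hence carries a 1 and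
   is itself the start of a letter image. *)
have hpos : 0 < lce (fib_morph w) (image_pos w p) (image_pos w q).
  by have := image_pos_mono w p (p + lce w p q); nlia.
rewrite ltnNge; apply/negP => Lr'.
have : 0 < lce (fib_morph w) (image_pos w p) r' by nlia.
move/(leq_lce nat 2); case; [nlia|nlia|move=> _ /(_ 0 isT)].
rewrite !addn0 nth_image_pos; last by nlia.
move=> /esym /image_pos_onto [r rN rE]; subst r'.
have pr : p < r.
  by rewrite ltnNge; apply/negP => rp; have := image_pos_mono w r p; nlia.
have rq : r < q.
  by rewrite ltnNge; apply/negP => qr; have := image_pos_mono w q r; nlia.
have lr := lce_image_pos w p r bw pr (ltnW rN).
have hrr := hr r pr rq.
have m1 := image_pos_mono w (p + lce w p r) (p + lce w p q).
have [e|[e lt]] : q + lce w p q < size w \/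
    q + lce w p q = size w /\ (lce w p r).+1 <= lce w p q by nlia.
  by nlia.
have [e'|e'] : (lce w p r).+1 = lce w p q \/ (lce w p r).+1 < lce w p q by nlia.
  have z : last 2 w <> 0.
    move=> z; apply: (tw p q r) => //.
    by apply/mcs_pairP; split=> //; nlia.
  have := image_posS w (p + lce w p r).
  rewrite -nth_last in z; rewrite lm; last by nlia.
  have -> : q + lce w p r = (size w).-1 by nlia.
  by rewrite -addnS e'; nlia.
by nlia.
Qed.

(* Number of runs of length 1 in [s], when [s] is preceded by the letter [a]
   and followed by the letter [e]. *)
Fixpoint num_isolated (a e : nat) (s : seq nat) : nat :=
  if s is x :: s' then ((a != x) && (x != head e s')) + num_isolated x e s' else 0.

Lemma num_isolatedE (a : nat) (s : seq nat) :
  num_isolated a 2 s =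
  count (fun p => (nth 2 (a :: s) p != nth 2 s p) && (nth 2 s p != nth 2 s p.+1))
    (iota 0 (size s)).
Proof.
elim: s a => [|x s IH] a //=; rewrite IH -nth0; congr (_ + _).
by rewrite -(addn0 1) iotaDl count_map.
Qed.

(** A zero extension cannot exceed another one, so no position lies between [p] and [q]. The default
    letter 2 is foreign to a binary word, so both ends of [w] count as changes of letter. *)
Lemma size_mcs_pairs_lce0 (w : seq nat) : binary w ->
  size [seq pq <- mcs_pairs 2 w | lce w pq.1 pq.2 == 0] = num_isolated 2 2 w.
Proof.
move=> bw; rewrite num_isolatedE -size_filter -(size_map (fun p => (p, p.+1))).
apply: perm_size; apply: uniq_perm.
- exact: filter_uniq (uniq_mcs_pairs _ _ _).
- by rewrite map_inj_uniq ?filter_uniq ?iota_uniq // => x y [].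
have lce1 p : p < size w -> (lce w p p.+1 == 0) = (nth 2 w p != nth 2 w p.+1).
  move=> pN; have := leq_lce nat 2 w p p.+1 1 (ltnSn p) pN.
  have := binary_nth w p bw pN.
  move=> wp h; rewrite -leqn0 leqNgt; congr (~~ _); apply/idP/eqP.
    by move/h => [_ /(_ 0 isT)]; rewrite !addn0.
  move=> e; apply/h; split; last by case=> // _; rewrite !addn0.
  by rewrite addn1 ltnNge; apply/negP => ?; move: wp; rewrite e nth_default.
move=> [p q]; rewrite mem_filter mem_mcs_pairs.
apply/andP/mapP.
  move=> [/= l0 /mcs_pairP[pq qN hl hr]].
  have qE : q = p.+1.
    by have [//|lt] : q = p.+1 \/ p.+1 < q by [lia]; have := hr p.+1; nlia.
  subst q; exists p => //; rewrite mem_filter mem_iota /= qN andbT -lce1 // l0 andbT.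
  case: p hl {hr pq l0} qN => [|p] /= hl pN; last by case: hl => // /eqP.
  by have := binary_nth w 0 bw pN; case: (nth _ _ _) => [|[]].
move=> [p']; rewrite mem_filter mem_iota => /andP[/andP[hl h1] /= pN] [-> ->] {p q}.
rewrite lce1 //; split=> //; apply/mcs_pairP; split=> //; last by nlia.
by case: p' hl {h1 pN} => [|p] /=; [left|move=> /eqP; right].
Qed.

Lemma size_mcs_pairs_fib_morph (w : seq nat) :
  binary w -> tail_ok w -> 1 < size w ->
  nth 2 w (size w).-2 != nth 2 w (size w).-1 ->
  (size (mcs_pairs 2 (fib_morph w))).+1 =
  size (mcs_pairs 2 w) + num_isolated 2 2 (fib_morph w).
Proof.
move=> bw tw N1 iso_last.
have bW := binary_fib_morph w.
rewrite -(count_predC (fun pq => lce (fib_morph w) pq.1 pq.2 == 0)).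
rewrite -!size_filter size_mcs_pairs_lce0 // addnC -addSn; congr (_ + _).
rewrite -[RHS](count_predC (fun pq => pq.2 < size w)) -!size_filter.
(* A border at [size w] is empty, so the only such pair is that of the last letter; it is maximal
   because the last two letters differ. *)
have -> : size [seq x <- mcs_pairs 2 w | predC (fun pq => pq.2 < size w) x] = 1.
  rewrite -[RHS]/(size [:: ((size w).-1, size w)]); apply: perm_size.
  apply: uniq_perm => //; first exact: filter_uniq (uniq_mcs_pairs _ _ _).
  move=> [p q]; rewrite mem_filter mem_mcs_pairs mem_seq1; apply/andP/eqP.
    move=> [/= qN /mcs_pairP[pq qN' hl hr]].
    have lN : lce w p q = 0.
      by have := (leq_lce nat 2 w p q (lce w p q) pq qN').1 (leqnn _); case; nlia.
    have := hr p.+1; have [e|?] : q = p.+1 \/ p.+1 < q by [lia].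
      by move=> _; congr pair; nlia.
    by nlia.
  move=> [-> ->] /=; rewrite ltnn; split=> //; apply/mcs_pairP.
  split=> //; [nlia| |nlia].
  by right; apply/eqP.
rewrite addn1; congr _.+1.
rewrite -[RHS](size_map (fun pq => (image_pos w pq.1, image_pos w pq.2))).
have mono p q : p < q -> q <= size w -> image_pos w p < image_pos w q.
  by move=> pq qN; have := image_pos_mono w p q (ltnW pq) qN; lia.
have inj p q : p <= size w -> q <= size w -> image_pos w p = image_pos w q -> p = q.
  move=> pN qN e; have [//|[lt|lt]] : p = q \/ (p < q \/ q < p) by lia.
    by have := mono _ _ lt qN; lia.
  by have := mono _ _ lt pN; lia.
apply: perm_size; apply: uniq_perm.
- exact: filter_uniq (uniq_mcs_pairs _ _ _).
- rewrite map_inj_in_uniq; first exact: filter_uniq (uniq_mcs_pairs _ _ _).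
  move=> [p q] [p' q']; rewrite mem_filter mem_mcs_pairs.
  move=> /andP[/= qN /mcs_pairP[pq _ _ _]]; rewrite mem_filter mem_mcs_pairs.
  move=> /andP[/= qN' /mcs_pairP[pq' _ _ _]].
  move=> /= [e1 e2]; have pp : p = p' by apply: inj e1; nlia.
  have qq : q = q' by apply: inj e2; nlia.
  by rewrite pp qq.
move=> [p' q']; rewrite mem_filter mem_mcs_pairs; apply/andP/mapP.
  move=> [/= l0 hpq]; case/mcs_pairP: (hpq) => pq qN hl hr.
  have [lN lm] := (leq_lce nat 2 _ p' q' (lce (fib_morph w) p' q') pq qN).1 (leqnn _).
  have e0 : nth 2 (fib_morph w) p' = nth 2 (fib_morph w) q'.
    by have := lm 0; rewrite !addn0; apply; nlia.
  (* A border starting with 0 would be preceded by 1 at both occurrences and could be extended to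
     the left. *)
  have q1 : nth 2 (fib_morph w) q' = 1.
    have := binary_nth _ q' bW; case E : (nth _ _ q') => [|[|?]] //; last first.
      by nlia.
    have [q0 qp] := zero_after_one _ _ E.
    have [p0 pp] := zero_after_one w p' (etrans e0 E).
    by case: hl; [nlia|rewrite qp pp].
  have [q qN' qE] := image_pos_onto _ _ q1.
  have [p pN' pE] := image_pos_onto w p' (etrans e0 q1).
  subst p' q'; exists (p, q) => //; rewrite mem_filter mem_mcs_pairs /= qN' /=.
  rewrite -mcs_pair_image_pos //.
  have [//|le] := ltnP p q.
  by have := image_pos_mono w q p le; lia.
move=> [[p q]]; rewrite mem_filter mem_mcs_pairs => /andP[/= qN hpq] [-> ->].
case/mcs_pairP: (hpq) => pq _ _ _.
rewrite mcs_pair_image_pos // hpq; split=> //=; rewrite -lt0n.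
have := lce_image_pos w p q bw pq (ltnW qN).
have [lN _] := (leq_lce nat 2 w p q (lce w p q) pq (ltnW qN)).1 (leqnn _).
have := image_pos_mono w p (p + lce w p q).
by nlia.
Qed.

(** * Fibonacci words *)

(** A 1 followed by 1 is the image of 0, so 111 would come from 00 in [fib_morph v], where every 0
    follows a 1. *)
Lemma no_111 (v : seq nat) (i : nat) :
  let w := fib_morph (fib_morph v) in
  nth 2 w i = 1 -> nth 2 w i.+1 = 1 -> nth 2 w i.+2 = 1 -> False.
Proof.
move=> w; rewrite {}/w; set w := fib_morph v.
have step j : nth 2 (fib_morph w) j = 1 -> nth 2 (fib_morph w) j.+1 = 1 ->
    exists r, [/\ r < size w, j = image_pos w r, nth 2 w r = 0
                & j.+1 = image_pos w r.+1].
  move=> /image_pos_onto [r rN ->] h1; exists r.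
  have w0 : nth 2 w r = 0.
    by apply: contrapT => w0; move: h1; rewrite nth_image_pos_succ.
  by split=> //; rewrite image_posS // w0 addn1.
move=> h0 h1 h2.
have [r [rN iE w0 iE1]] := step i h0 h1.
have [s [sN jE w1 _]] := step i.+1 h1 h2.
have rs : r.+1 = s.
  have [//|[lt|lt]] : r.+1 = s \/ (r.+1 < s \/ s < r.+1) by lia.
    by have := image_pos_mono w r.+1 s (ltnW lt) (ltnW sN); lia.
  by have := image_pos_mono w s r.+1 (ltnW lt) rN; lia.
by have [_] := zero_after_one v s w1; rewrite -rs /= -/w w0.
Qed.

(* A suffix [b0] of length at least 3 ends in 110, so [b1] would end in 111,
   which is not a factor; shorter suffixes are preceded by the same letter at
   both occurrences. *)
Lemma tail_ok_110110 (u v : seq nat) (w := u ++ [:: 1; 1; 0; 1; 1; 0]) :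
  w = fib_morph (fib_morph v) -> tail_ok w.
Proof.
move=> wE.
have sw : size w = size u + 6 by rewrite size_cat.
have nw k i : i = size u + k -> nth 2 w i = nth 2 [:: 1; 1; 0; 1; 1; 0] k.
  by move=> ->; rewrite nth_cat ltnNge leq_addr addKn.
have bw : binary w by rewrite wE; exact: binary_fib_morph.
have zero_pred i : nth 2 w i = 0 -> 0 < i /\ nth 2 w i.-1 = 1.
  by rewrite wE; exact: zero_after_one.
have no111 i : nth 2 w i = 1 -> nth 2 w i.+1 = 1 -> nth 2 w i.+2 = 1 -> False.
  by rewrite wE; exact: no_111.
clearbody w; clear wE.
move=> p q r /mcs_pairP[pq qN hl hr] pr rq qL _ Lr.
have [_ lm] := (leq_lce nat 2 w p q (lce w p q) pq qN).1 (leqnn _).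
have [rN lr] := (leq_lce nat 2 w p r (lce w p r) pr (ltnW (leq_trans rq qN))).1 (leqnn _).
have [L1|[L2|L3]] : lce w p q = 1 \/ (lce w p q = 2 \/ 3 <= lce w p q) by lia.
- have := lm 0; rewrite L1 !addn0 (nw 5 q); last by nlia.
  move=> /(_ isT) /zero_pred [p0 pp]; case: hl => [|hl]; first by lia.
  by apply: hl; rewrite pp (nw 4) //; nlia.
- have := lm 0; have := lm 1; rewrite L2 !addn0 (nw 5 (q + 1)) ?(nw 4 q); [|nlia|nlia].
  move=> /(_ isT) p1 /(_ isT) p0.
  (* Here the border is 10 and [q = size u + 4]. It also occurs at [size u + 1], which excludes
     smaller [p]; at [p = size u + 1] both occurrences follow a 1; the last two positions do not
     carry 10. *)
  have [lt|[e|[e|e]]] : p < size u + 1 \/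
    (p = size u + 1 \/ (p = size u + 2 \/ p = size u + 3)) by nlia.
  + have := hr (size u + 1) lt; rewrite L2.
    have : 2 <= lce w p (size u + 1).
      apply/(leq_lce nat 2) => //; [nlia|split; first by nlia].
      case=> [|[|//]] _; rewrite ?addn0 ?p0 ?p1.
        by rewrite (nw 1).
      by rewrite (nw 2) //; lia.
    by nlia.
  + case: hl => [|hl]; first by lia.
    by apply: hl; rewrite (nw 0 p.-1) ?(nw 3 q.-1) //; nlia.
  + by move: p0; rewrite e (nw 2).
  + by move: p1; rewrite e (nw 4) //; lia.
have rl i : i < lce w p r -> nth 2 w (r + i) = nth 2 w (q + i).
  by move=> il; rewrite -lr // lm //; lia.
set L := lce w p r in Lr rl lr rN.
(* The occurrence at [r] copies all of the border but its final 0, hence ends in 11. The next letter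
   cannot be 0, as the agreement would then be longer than [L]. *)
apply: (no111 (r + (L - 2))).
- by rewrite rl ?(nw 3) //; nlia.
- by rewrite -addnS rl ?(nw 4) //; nlia.
have -> : (r + (L - 2)).+2 = r + L by lia.
have : nth 2 w (r + L) < 2 by apply: binary_nth => //; nlia.
case E : (nth 2 w (r + L)) => [|[|//]] // _.
suff : L.+1 <= lce w p r by rewrite ltnn.
apply/(leq_lce nat 2) => //; [nlia|split; first by nlia].
move=> i iL; have [lt|->] : i < L \/ i = L by lia.
  exact: lr.
by rewrite E lm ?(nw 5) //; nlia.
Qed.

Lemma num_isolated_cat (a e : nat) (u v : seq nat) :
  num_isolated a e (u ++ v) = num_isolated a (head e v) u + num_isolated (last a u) e v.
Proof.
elim: u a => //= x u IH a; rewrite IH addnA; congr (_ + _ + _).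
by case: u {IH}.
Qed.

Lemma fib_word_prefix (n : nat) : exists v, fib_word n.+2 = 1 :: 0 :: v.
Proof.
elim: n => [|n [v IH]]; first by exists [::].
by exists (v ++ fib_word n.+1); rewrite -!cat_cons -IH.
Qed.

Lemma fib_word_suffix (n : nat) :
  exists u, fib_word n.+2 = u ++ (if odd n then [:: 0; 1] else [:: 1; 0]).
Proof.
suff : (exists u, fib_word n.+2 = u ++ (if odd n then [:: 0; 1] else [:: 1; 0])) /\
  (exists u, fib_word n.+3 = u ++ (if odd n.+1 then [:: 0; 1] else [:: 1; 0])).
  by case.
elim: n => [|n [IH1 IH2]]; first by split; [exists [::]|exists [:: 1]].
split=> //; case: IH1 => u e; exists (fib_word n.+3 ++ u).
by rewrite -catA /= negbK -e.
Qed.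

(** Each word ends with the word two indices earlier, so the suffix is inherited from index 6. *)
Lemma fib_word_suffix6 (k : nat) :
  exists u, fib_word (k.*2 + 6) = u ++ [:: 1; 1; 0; 1; 1; 0].
Proof.
elim: k => [|k [u e]]; first by exists [:: 1; 0; 1; 1; 0; 1; 0].
exists (fib_word (k.*2 + 7) ++ u); rewrite -catA -e doubleS.
by rewrite !addSn !addnS.
Qed.

Lemma fib_lenSS (n : nat) : fib_len n.+2 = fib_len n.+1 + fib_len n.
Proof. exact: size_cat. Qed.

(** Only the junction matters, and the right factor starts with 10. After a left factor ending in 10
    nothing changes; after 01 the two 1s merge into a run, and two isolated letters are lost. *)
Lemma num_isolated_fib_wordSS (n : nat) : 2 <= n ->
  num_isolated 2 2 (fib_word n.+2) + (~~ odd n).*2 =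
  num_isolated 2 2 (fib_word n.+1) + num_isolated 2 2 (fib_word n).
Proof.
case: n => [|[|n]] // _.
have -> : fib_word n.+4 = fib_word n.+3 ++ fib_word n.+2 by [].
rewrite num_isolated_cat; have [v ->] := fib_word_prefix n.
have [u ->] := fib_word_suffix n.+1; rewrite /= negbK.
by case: (odd n); rewrite /= !num_isolated_cat last_cat /=; lia.
Qed.

Lemma num_isolated_fib_word (k : nat) :
  num_isolated 2 2 (fib_word k.+4) = fib_len k.+2 + fib_len k + (odd k).*2.
Proof.
suff : num_isolated 2 2 (fib_word k.+4) = fib_len k.+2 + fib_len k + (odd k).*2 /\
  num_isolated 2 2 (fib_word k.+1.+4) = fib_len k.+3 + fib_len k.+1 + (odd k.+1).*2.
  by case.
elim: k => [//|k [IH1 IH2]]; split=> //.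
have := num_isolated_fib_wordSS k.+4 isT; rewrite IH1 IH2.
rewrite (fib_lenSS k.+2) (fib_lenSS k) /= !negbK.
by case: (odd k) => /=; lia.
Qed.

(** The shift by 5 reverses parity: odd [k] are the even indices, with correction 2. The base case
    is evaluated. *)
Lemma size_mcs_pairs_fib_word (k : nat) :
  size (mcs_pairs 2 (fib_word (k + 5))) + (odd k).+1 =
  fib_len (k + 5) + fib_len (k + 3).
Proof.
elim: k => [//|k IH].
have wE : fib_word (k + 5) = fib_morph (fib_morph (fib_word (k + 3))).
  by rewrite -!fib_word_morph -!addnS.
have tw : tail_ok (fib_word (k + 5)).
  (* At even indices the word ends in 0 and the suffix 110110 is needed; at odd ones it ends in 1,
     so [tail_ok] holds vacuously. *)
  have [ok|ek] := boolP (odd k).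
    have := odd_double_half k; rewrite ok => kE.
    have [u e] := fib_word_suffix6 k./2.
    have e' : k./2.*2 + 6 = k + 5 by lia.
    rewrite e' in e; rewrite e in wE *.
    exact: tail_ok_110110 wE.
  have [u e] := fib_word_suffix (k + 3).
  move=> p q r _ _ _ _; rewrite -[k + 5]/(k + (3 + 2)) addnA addn2 e oddD (negbTE ek).
  by rewrite last_cat.
have [u e] := fib_word_suffix (k + 3).
have e2 : (k + 3).+2 = k + 5 by lia.
rewrite e2 in e.
have := size_mcs_pairs_fib_morph (fib_word (k + 5)).
rewrite -fib_word_morph -addSn => /(_ _ tw) h.
have {h} : (size (mcs_pairs 2 (fib_word (k.+1 + 5)))).+1 =
    size (mcs_pairs 2 (fib_word (k + 5))) + num_isolated 2 2 (fib_word (k.+1 + 5)).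
  apply: h; first by rewrite wE; exact: binary_fib_morph.
    by rewrite e size_cat; case: (odd _) => /=; lia.
  rewrite e size_cat; case: (odd _); rewrite /= addn2 /= nth_cat ltnn subnn.
    by rewrite nth_cat ltnNge leqnSn subSnn.
  by rewrite nth_cat ltnNge leqnSn subSnn.
rewrite !addSn; move: IH; rewrite !addnS !addn0; have := num_isolated_fib_word k.+2.
have := fib_lenSS k.+4; have := fib_lenSS k.+2.
rewrite /= !negbK.
by case: (odd k) => /=; lia.
Qed.

(** * Asymptotics *)

Lemma num_mcs_fib_word (n : nat) : 5 <= n ->
  num_mcs (fib_word n) + (~~ odd n).+1 = fib_len n + fib_len (n - 2).
Proof.
move=> n5; rewrite (num_mcsE nat 2).
have -> : n = (n - 5) + 5 by lia.
have := size_mcs_pairs_fib_word (n - 5).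
have -> : n - 5 + 5 - 2 = n - 5 + 3 by lia.
by rewrite oddD addbT negbK.
Qed.

Lemma leq_fib_len (n : nat) : n <= fib_len n.
Proof.
suff : [/\ n <= fib_len n, n.+1 <= fib_len n.+1 & 1 <= fib_len n] by case.
elim: n => [//|n [IH0 IH1 IH2]]; split=> //; last by lia.
by rewrite fib_lenSS; lia.
Qed.

Local Open Scope ring_scope.

Lemma sqrt5_sqr (R : realType) : Num.sqrt 5 ^+ 2 = 5 :> R.
Proof. by rewrite sqr_sqrtr. Qed.

Lemma golden_sqr (R : realType) : golden R ^+ 2 = golden R + 1.
Proof. by rewrite /golden; have := sqrt5_sqr R; lra. Qed.

(** For [s] in this interval, [1 + (3 - s) / 2] lies within 5/10000 of 1.382; the endpoints are
    exactly those of that tolerance. *)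
Lemma sqrt5_bounds (R : realType) : 2235 / 1000 < Num.sqrt (5 : R) < 2237 / 1000.
Proof.
have s0 : 0 <= Num.sqrt 5 :> R by exact: sqrtr_ge0.
have := sqrt5_sqr R.
by move: (Num.sqrt 5) s0 => s s0 s2; apply/andP; split; nra.
Qed.

Lemma inv_golden_sqr (R : realType) : 1 / golden R ^+ 2 = (3 - Num.sqrt 5) / 2 :> R.
Proof.
have := sqrt5_sqr R; have := sqrt5_bounds R.
rewrite golden_sqr /golden; move: (Num.sqrt 5) => s /andP[s1 s2] s5.
have h : (1 + s) / 2 + 1 != 0 by apply/eqP; lra.
by apply: (mulIf h); rewrite divfK //; lra.
Qed.

(** Each step multiplies the difference by [1 - golden R], the conjugate root, of absolute value
    below 1. *)
Lemma golden_fib_len (R : realType) (n : nat) :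
  `|(fib_len n.+1)%:R - golden R * (fib_len n)%:R| <= 1 :> R.
Proof.
have /andP[s1 s2] := sqrt5_bounds R.
elim: n => [|n IH].
  rewrite (_ : fib_len 1 = 1%N) // (_ : fib_len 0 = 1%N) //.
  by rewrite ler_norml /golden; apply/andP; split; lra.
have -> : (fib_len n.+2)%:R - golden R * (fib_len n.+1)%:R =
    (1 - golden R) * ((fib_len n.+1)%:R - golden R * (fib_len n)%:R) :> R.
  have := golden_sqr R; rewrite fib_lenSS natrD.
  move: (golden R) (fib_len n.+1)%:R (fib_len n)%:R => f a b f2.
  have -> : (1 - f) * (a - f * b) = a - f * a + (f ^+ 2 - f) * b by ring.
  by rewrite f2; ring.
rewrite normrM mulr_ile1 //.
by rewrite ler_norml /golden; apply/andP; split; lra.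
Qed.

(** Since the square of [golden R] is [golden R + 1], the numerator over the common denominator is,
    up to sign, the difference bounded in [golden_fib_len]. *)
Lemma fib_len_ratio (R : realType) (n : nat) :
  `|(fib_len n)%:R / (fib_len n.+2)%:R - 1 / golden R ^+ 2| <= 1 / (fib_len n.+2)%:R :> R.
Proof.
have F0 : 0 < (fib_len n.+2)%:R :> R by rewrite ltr0n; have := leq_fib_len n.+2; lia.
have p1 : 1 <= golden R ^+ 2.
  by have /andP[s1 s2] := sqrt5_bounds R; rewrite golden_sqr /golden; lra.
have -> : (fib_len n)%:R / (fib_len n.+2)%:R - 1 / golden R ^+ 2 =
   - ((fib_len n.+1)%:R - golden R * (fib_len n)%:R) / golden R ^+ 2 / (fib_len n.+2)%:R :> R.
  have -> : - ((fib_len n.+1)%:R - golden R * (fib_len n)%:R) =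
      (fib_len n)%:R * golden R ^+ 2 - (fib_len n.+2)%:R :> R.
    by rewrite golden_sqr fib_lenSS natrD; ring.
  by field; rewrite lt0r_neq0 //=; apply/eqP => p0; move: p1; rewrite p0; lra.
rewrite normrM normfV (gtr0_norm F0) ler_pM2r ?invr_gt0 //.
rewrite normrM normfV (ger0_norm (le_trans ler01 p1)) normrN ler_pdivrMr; last by lra.
by rewrite mul1r (le_trans (golden_fib_len R n)).
Qed.

Local Close Scope ring_scope.

Theorem theorem7 (R : realType) :
  [/\ forall n : nat, 5 <= n ->
        num_mcs (fib_word n) =
          if odd n then fib_len n + fib_len (n - 2) - 1
          else fib_len n + fib_len (n - 2) - 2,
      forall n : nat, 5 <= n ->
        num_mcs (fib_word n) < fib_len n + fib_len (n - 2),
      ((fun n : nat => (num_mcs (fib_word n))%:R / (fib_len n)%:R : R)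
         @ \oo --> (1 + 1 / golden R ^+ 2 : R))%classic%R
    & (`|1 + 1 / golden R ^+ 2 - 1382 / 1000| < 5 / 10000 :> R)%R].
Proof.
split.
- by move=> n /num_mcs_fib_word <-; case: (odd n) => /=; lia.
- by move=> n /num_mcs_fib_word <-; lia.
- apply/cvgrPdist_le => e e0; near=> n.
  have n5 : 5 <= n by near: n; exact: nbhs_infty_ge.
  (* The total error is at most [3 / F]: [1 / F] from the ratio and [2 / F] from the parity
     correction [c]. *)
  have ne : (3 / e <= n%:R)%R by near: n; exact: nbhs_infty_ger.
  have hm := num_mcs_fib_word n n5; have nF := leq_fib_len n.
  have mE : (n - 2).+2 = n by lia.
  have := fib_len_ratio R (n - 2); rewrite mE => hr.
  set m := n - 2 in hm hr mE.
  set F : R := (fib_len n)%:R%R in hr *.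
  have nF' : (n%:R <= F)%R by rewrite ler_nat.
  have F0 : (0 < F)%R by rewrite ltr0n; lia.
  set c := (~~ odd n).+1 in hm.
  have hc : (0 <= (c%:R : R) <= 2)%R by rewrite ler0n ler_nat /c; case: (odd n).
  have -> : ((num_mcs (fib_word n))%:R = F + (fib_len m)%:R - c%:R :> R)%R.
    by rewrite -natrD -hm natrD addrK.
  rewrite distrC; have -> : ((F + (fib_len m)%:R - c%:R) / F - (1 + 1 / golden R ^+ 2) =
      ((fib_len m)%:R / F - 1 / golden R ^+ 2) - c%:R / F)%R.
    by rewrite !mulrDl divff ?lt0r_neq0 // mulNr; ring.
  apply: le_trans (ler_normB _ _) _.
  have hcF : (`|c%:R / F| <= 2 / F)%R.
    have /andP[c0 c2] := hc.
    by rewrite ger0_norm ?divr_ge0 ?ler_pM2r ?invr_gt0 // ltW.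
  apply: le_trans (lerD hr hcF) _.
  rewrite -mulrDl ler_pdivrMr // mulrC -ler_pdivrMr //.
  by apply: le_trans nF'; apply: le_trans ne; lra.
- have /andP[s1 s2] := sqrt5_bounds R.
  by rewrite inv_golden_sqr ltr_norml; apply/andP; split; lra.
Unshelve. all: by end_near.
Qed.
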